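(* Let $X$ be a Banach lattice. The following are equivalent: (i) the un-topology on $X$ agrees with the norm topology on $X$; (ii) $X$ has a strong unit.
   Context: Let $X$ be a Banach lattice with positive cone $X_+$. A net $(x_\alpha)$ in $X$ un-converges to $x\in X$ if $\bigl\lVert |x_\alpha-x|\wedge u\bigr\rVert\to 0$ for every $u\in X_+$. The un-topology on $X$ is the linear topology whose base of zero neighborhoods is given by the sets $V_{\varepsilon,u}=\{x\in X : \lVert |x|\wedge u\rVert<\varepsilon\}$, where $\varepsilon>0$ and $0\ne u\in X_+$; convergence of nets in this topology is exactly un-convergence. A vector $e\in X_+$ is a strong unit if for every $x\in X_+$ there exists $n\in\mathbb N$ such that $x\le ne$ (equivalently, the principal ideal $I_e$ generated by $e$ equals $X$). *)

(* Defs.v *)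
From HB Require Import structures.
From mathcomp Require Import all_boot all_order all_algebra.
From mathcomp Require Import all_classical all_reals all_analysis.

Set Implicit Arguments.
Unset Strict Implicit.
Unset Printing Implicit Defensive.

Import Order.TTheory GRing.Theory Num.Theory.
Import numFieldNormedType.Exports.

Local Open Scope classical_set_scope.
Local Open Scope ring_scope.

(* Hierarchy-Builder rejects a common extension of Order.Lattice and
   CompleteNormedModule (it would create a missing join with Num.NumDomain), so
   the order and the lattice operations are fields here. The library notations
   (<=, Order.join, Order.meet) are recovered by the instances below. *)
HB.mixin Record isBanachLattice (R : realType) (X : Type)
    & CompleteNormedModule R X := {
  bl_le : rel X ;
  bl_join : X -> X -> X ;
  bl_meet : X -> X -> X ;
  bl_le_refl : reflexive bl_le ;
  bl_le_anti : antisymmetric bl_le ;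
  bl_le_trans : transitive bl_le ;
  bl_leUx : forall x y z : X,
    bl_le (bl_join x y) z = bl_le x z && bl_le y z ;
  bl_lexI : forall x y z : X,
    bl_le x (bl_meet y z) = bl_le x y && bl_le x z ;
  bl_leD2r : forall z x y : X, bl_le x y -> bl_le (x + z) (y + z) ;
  bl_scale_ge0 : forall (a : R) (x : X),
    0 <= a -> bl_le 0 x -> bl_le 0 (a *: x) ;
  (* |x| <= |y| -> ||x|| <= ||y||, where |x| = x \/ - x *)
  bl_norm_le : forall x y : X,
    bl_le (bl_join x (- x)) (bl_join y (- y)) -> `|x| <= `|y|
}.

#[short(type="banachLatticeType")]
HB.structure Definition BanachLattice (R : realType) :=
  {X of CompleteNormedModule R X & isBanachLattice R X}.

HB.instance Definition _ (R : realType) (X : banachLatticeType R) :=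
  Order.Le_isPOrder.Build ring_display (BanachLattice.sort X)
    (@bl_le_refl R X) (@bl_le_anti R X) (@bl_le_trans R X).

HB.instance Definition _ (R : realType) (X : banachLatticeType R) :=
  Order.POrder_MeetJoin_isLattice.Build ring_display (BanachLattice.sort X)
    (@bl_lexI R X) (@bl_leUx R X).

(* The lattice modulus |x|; the notation `|x| is the norm. *)
Definition modulus (R : realType) (X : banachLatticeType R) (x : X) : X :=
  Order.join x (- x).

Section BanachLatticeTheory.
Context (R : realType) (X : banachLatticeType R).
Implicit Types (x y z u v : X) (e : R).

Lemma vleD2r z x y : x <= y -> x + z <= y + z.
Proof. exact: bl_leD2r. Qed.

Lemma vsubr_le x y z : (x - y <= z) = (x <= z + y).
Proof.
apply/idP/idP => [/(vleD2r y)|/(vleD2r (- y))]; first by rewrite subrK.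
by rewrite addrK.
Qed.

Lemma vleD x y z v : x <= y -> z <= v -> x + z <= y + v.
Proof.
move=> xy zv; apply: le_trans (vleD2r z xy) _.
by rewrite ![y + _]addrC; exact: vleD2r.
Qed.

Lemma vscale_ge0 (a : R) x : 0 <= a -> 0 <= x -> 0 <= a *: x.
Proof. exact: bl_scale_ge0. Qed.

Lemma le_modulus x : x <= modulus x.
Proof. by rewrite leUl. Qed.

Lemma leN_modulus x : - x <= modulus x.
Proof. by rewrite leUr. Qed.

Lemma modulus_ge0 x : 0 <= modulus x.
Proof.
have := vleD (le_modulus x) (leN_modulus x); rewrite subrr => h.
have : 0 <= 2^-1 *: (modulus x + modulus x).
  by apply: vscale_ge0 => //; rewrite invr_ge0.
by rewrite -mulr2n -[modulus x *+ 2]scaler_nat scalerA mulVf ?scale1r ?pnatr_eq0.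
Qed.

Lemma modulus_id x : 0 <= x -> modulus x = x.
Proof.
move=> x0; apply/join_idPl; apply: le_trans (x0).
by have := vleD2r (- x) x0; rewrite add0r subrr.
Qed.

Lemma modulus0 : modulus (0 : X) = 0.
Proof. exact: modulus_id. Qed.

Lemma norm_le_modulus x y : modulus x <= modulus y -> `|x| <= `|y|.
Proof. exact: bl_norm_le. Qed.

Lemma vler_norm x y : 0 <= x -> x <= y -> `|x| <= `|y|.
Proof.
move=> x0 xy; apply: norm_le_modulus.
by rewrite !modulus_id// (le_trans x0).
Qed.

Lemma ler_modulusD x y : modulus (x + y) <= modulus x + modulus y.
Proof.
rewrite leUx opprD; apply/andP.
by split; apply: vleD; rewrite ?le_modulus ?leN_modulus.
Qed.

Lemma meetDl_le x y u : 0 <= x -> 0 <= y -> 0 <= u ->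
  Order.meet (x + y) u <= Order.meet x u + Order.meet y u.
Proof.
move=> x0 y0 u0; have yu0 : 0 <= Order.meet y u by rewrite lexI y0.
rewrite -vsubr_le lexI; apply/andP; split.
  rewrite vsubr_le [x + Order.meet _ _]addrC -vsubr_le lexI; apply/andP; split.
    by rewrite vsubr_le [y + x]addrC leIl.
  rewrite vsubr_le; apply: le_trans (leIr _ _) _.
  by rewrite -{1}[u]addr0; exact: vleD.
rewrite vsubr_le; apply: le_trans (leIr _ _) _.
by rewrite -{1}[u]addr0; exact: vleD.
Qed.

Lemma normr_meetD u x y : 0 <= u ->
  `|Order.meet (modulus (x + y)) u| <=
  `|Order.meet (modulus x) u| + `|Order.meet (modulus y) u|.
Proof.
move=> u0; apply: le_trans (ler_normD _ _); apply: vler_norm.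
  by rewrite lexI modulus_ge0.
apply: le_trans (meetDl_le (modulus_ge0 x) (modulus_ge0 y) u0).
by apply: leI2 => //; exact: ler_modulusD.
Qed.

(* The basic zero neighborhood V_{e,u} *)
Definition un_ball e u : set X := [set x | `|Order.meet (modulus x) u| < e].

(* The neighborhood filter of x generated by the translates x + V_{e,u}, for
   e > 0 and u >= 0. Allowing u = 0 adds only the whole space to the base,
   which matters only for X = {0}, where no u >= 0 is nonzero. *)
Definition un_nbhs x : set_system X :=
  filter_from [set eu : R * X | 0 < eu.1 /\ 0 <= eu.2]
    (fun eu => [set y | un_ball eu.1 eu.2 (y - x)]).

Lemma un_ball0 e u : 0 < e -> 0 <= u -> un_ball e u 0.
Proof.
by move=> e0 u0; rewrite /un_ball/= modulus0 (meet_idPl u0) normr0.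
Qed.

Lemma un_ball_mono e1 e2 u1 u2 : 0 <= u1 -> e1 <= e2 -> u1 <= u2 ->
  un_ball e1 u2 `<=` un_ball e2 u1.
Proof.
move=> u0 e12 u12 x /= h; apply: lt_le_trans e12; apply: le_lt_trans h.
by apply: vler_norm; [rewrite lexI modulus_ge0|exact: leI2].
Qed.

Lemma un_nbhs_filter x : ProperFilter (un_nbhs x).
Proof.
apply: filter_from_proper => [|[e u] [/= e0 u0]]; last first.
  by exists x; rewrite /= subrr; exact: un_ball0.
apply: filter_from_filter; first by exists (1, 0); split => //=.
move=> [e1 u1] [e2 u2] [/= e10 u10] [/= e20 u20].
exists (Num.min e1 e2, Order.join u1 u2).
  by split => /=; [rewrite lt_min e10|exact: le_trans (leUl _ _)].
move=> y /= h; split; apply: un_ball_mono h => //.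
- by rewrite ge_min lexx.
- exact: leUl.
- by rewrite ge_min lexx orbT.
- exact: leUr.
Qed.

Lemma un_nbhs_singleton x (A : set X) : un_nbhs x A -> A x.
Proof.
by move=> [[e u] [/= e0 u0]]; apply; rewrite /= subrr; exact: un_ball0.
Qed.

Lemma un_nbhs_nbhs x (A : set X) : un_nbhs x A -> un_nbhs x (un_nbhs^~ A).
Proof.
move=> [[e u] [/= e0 u0] hA].
exists (e / 2, u) => /=; first by rewrite divr_gt0.
move=> y /= hy; exists (e / 2, u) => /=; first by rewrite divr_gt0.
move=> z /= hz; apply: hA; rewrite /= -(subrK y z) -addrA.
apply: le_lt_trans (normr_meetD _ _ u0) _.
by rewrite [e]splitr ltrD.
Qed.

End BanachLatticeTheory.

(* X endowed with the un-topology *)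
Definition un_type (R : realType) (X : banachLatticeType R) : Type := X.

HB.instance Definition _ (R : realType) (X : banachLatticeType R) :=
  Choice.on (un_type X).

HB.instance Definition _ (R : realType) (X : banachLatticeType R) :=
  hasNbhs.Build (un_type X) (@un_nbhs R X).

HB.instance Definition _ (R : realType) (X : banachLatticeType R) :=
  Nbhs_isNbhsTopological.Build (un_type X)
    (@un_nbhs_filter R X) (@un_nbhs_singleton R X) (@un_nbhs_nbhs R X).

Definition un_open (R : realType) (X : banachLatticeType R) (A : set X) : Prop :=
  @open (un_type X) A.

(* Convergence in un_type X is un-convergence, with filters for nets. *)
Lemma un_cvgP (R : realType) (X : banachLatticeType R) (F : set_system X)
    {FF : Filter F} (x : X) :
  (F --> (x : un_type X)) <->
  (forall u : X, 0 <= u ->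
    (fun y : X => `|Order.meet (modulus (y - x)) u|) @ F --> (0 : R)).
Proof.
split=> [Fx u u0|Fx A [[e u] [/= e0 u0] hA]].
  apply/cvgr0Pnorm_lt => e e0; apply: Fx; exists (e, u) => //= y.
  by rewrite /= normr_id.
have /cvgr0Pnorm_lt /(_ e e0) := Fx u u0.
by apply: filterS => y; rewrite normr_id; exact: hA.
Qed.

Definition strong_unit (R : realType) (X : banachLatticeType R) (e : X) : Prop :=
  0 <= e /\ forall x : X, 0 <= x -> exists n : nat, x <= e *+ n.

(* Main.v *)
(* (i) => (ii): if V_{eps,u} is norm bounded, then it contains no nonzero
   vector together with all its multiples. But for x >= 0 in V_{eps,u}, all multiples of
   (x - u)^+ = x - x /\ u lie in V_{eps,u}, so x <= u. Every x >= 0 has a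
   multiple x / n in V_{eps,u}, hence u is a strong unit.
   (ii) => (i): by completeness, a strong unit e dominates all positive vectors
   of small norm. If |x| /\ 2e has small norm, then |x| /\ 2e <= e, which forces
   |x| <= e because a positive vector disjoint from e is 0; hence
   |x| = |x| /\ 2e is small in norm. *)
Require Import Defs.
From HB Require Import structures.
From mathcomp Require Import all_boot all_order all_algebra.
From mathcomp Require Import all_classical all_reals all_analysis.
Import Order.TTheory GRing.Theory Num.Theory.
Import numFieldNormedType.Exports.
Local Open Scope classical_set_scope.
Local Open Scope ring_scope.

Section UnTopologyStrongUnit.
Set Implicit Arguments.
Unset Strict Implicit.
Unset Printing Implicit Defensive.

Context (R : realType) (X : banachLatticeType R).
Implicit Types (x y z u : X).

Lemma vsubr_ge0 x y : (0 <= y - x) = (x <= y).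
Proof.
apply/idP/idP => [/(vleD2r x)|/(vleD2r (- x))]; first by rewrite add0r subrK.
by rewrite subrr.
Qed.

Lemma vscaler_le (a : R) x y : 0 <= a -> x <= y -> a *: x <= a *: y.
Proof.
by move=> a0 xy; rewrite -vsubr_ge0 -scalerBr vscale_ge0// vsubr_ge0.
Qed.

Lemma vmulrn_ge0 x n : 0 <= x -> 0 <= x *+ n.
Proof. by move=> x0; rewrite -scaler_nat vscale_ge0. Qed.

Lemma vmulrn_le x y n : x <= y -> x *+ n <= y *+ n.
Proof. by move=> xy; rewrite -(scaler_nat n x) -(scaler_nat n y) vscaler_le. Qed.

Lemma vmulrSn_le x y n : (x *+ n.+1 <= y *+ n.+1) = (x <= y).
Proof.
apply/idP/idP; last exact: vmulrn_le.
rewrite -(scaler_nat _ x) -(scaler_nat _ y) => /(@vscaler_le n.+1%:R^-1).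
by rewrite !scalerA mulVf ?pnatr_eq0// !scale1r; apply; rewrite invr_ge0.
Qed.

Lemma vsum_ge0 (v : nat -> X) m n : (forall k, 0 <= v k) ->
  0 <= \sum_(m <= i < n) v i.
Proof.
move=> v0; apply: (big_ind (fun x => 0 <= x)) => // x y x0 y0.
by rewrite -[0]addr0 vleD.
Qed.

Lemma normr_modulus x : `|modulus x| = `|x|.
Proof.
have h : modulus (modulus x) = modulus x by rewrite modulus_id// modulus_ge0.
by apply/le_anti/andP; split; apply: norm_le_modulus; rewrite h.
Qed.

Lemma normr_meet_le x u : 0 <= u -> `|Order.meet (modulus x) u| <= `|x|.
Proof.
move=> u0; rewrite -(normr_modulus x); apply: vler_norm; last exact: leIl.
by rewrite lexI modulus_ge0.
Qed.

(** Adding [x /\ u] to this meet yields a lower bound of both [x] and [u], hence an element below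
    [x /\ u]. *)
Lemma sub_meet_disjoint x u :
  Order.meet (x - Order.meet x u) (u - Order.meet x u) <= 0.
Proof.
set m : X := Order.meet (x - Order.meet x u) _.
have : m + Order.meet x u <= Order.meet x u.
  rewrite lexI; apply/andP; split.
    by rewrite -[leRHS](subrK (Order.meet x u)) vleD2r// leIl.
  by rewrite -[leRHS](subrK (Order.meet x u)) vleD2r// leIr.
by move/(vleD2r (- Order.meet x u)); rewrite addrK subrr.
Qed.

Lemma meet_mulrn_le0 x y n : 0 <= x -> 0 <= y ->
  Order.meet x y <= 0 -> Order.meet (x *+ n) y <= 0.
Proof.
move=> x0 y0 xy; elim: n => [|n IHn]; first by rewrite mulr0n leIl.
rewrite mulrS; apply: le_trans (meetDl_le x0 (vmulrn_ge0 n x0) y0) _.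
by rewrite -[0]addr0 vleD.
Qed.

(* [x - x /\ u] is disjoint from [u - x /\ u], hence so are its multiples. *)
Lemma meet_mulrn_sub_le x u n : 0 <= x -> 0 <= u ->
  Order.meet ((x - Order.meet x u) *+ n) u <= Order.meet x u.
Proof.
move=> x0 u0.
have y0 : 0 <= x - Order.meet x u by rewrite vsubr_ge0 leIl.
have z0 : 0 <= u - Order.meet x u by rewrite vsubr_ge0 leIr.
have m0 : 0 <= Order.meet x u by rewrite lexI x0.
(* Split [u] as [(u - x /\ u) + x /\ u]; by subadditivity of the meet only the first summand needs
   disjointness. *)
rewrite -{2}(subrK (Order.meet x u) u) meetC.
apply: le_trans (meetDl_le z0 m0 (vmulrn_ge0 n y0)) _.
rewrite -[leRHS]add0r; apply: vleD; last exact: leIl.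
by rewrite meetC; apply: meet_mulrn_le0 => //; exact: sub_meet_disjoint.
Qed.

(** The positive part of [c - x] lies below the modulus of [f n - x] as soon as [c <= f n], so its
    norm is arbitrarily small. *)
Lemma cvg_vge (f : nat -> X) (x c : X) : (f @ \oo --> x) ->
  (\forall n \near \oo, c <= f n) -> c <= x.
Proof.
move=> /cvgrPdist_lt fx cf.
pose p := Order.join (c - x) 0.
have p0 : 0 <= p by exact: leUr.
suff : p = 0 by move=> /eqP; rewrite eq_le leUx vsubr_le add0r => /andP[/andP[]].
apply/eqP; rewrite -normr_le0; apply/ler_addgt0Pr => e e0; rewrite add0r.
have [n [/= fn cn]] := filter_ex (filterI (fx e e0) cf).
apply: le_trans (ltW fn); rewrite distrC -(normr_modulus (f n - x)).
apply: vler_norm => //.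
rewrite leUx modulus_ge0 andbT; apply: le_trans (le_modulus _).
exact: vleD2r.
Qed.

Lemma vle_lim_series (v : nat -> X) k : (forall n, 0 <= v n) ->
  cvgn (series v) -> v k <= limn (series v).
Proof.
move=> v0 cv; apply: cvg_vge cv _; near=> n.
have kn : (k < n)%N by near: n; exact: nbhs_infty_gt.
rewrite seriesEnat/= (big_cat_nat (n := k))//=; last exact: ltnW.
rewrite (big_ltn kn) addrCA -[leLHS]addr0 vleD// -[leLHS]addr0 vleD//.
  exact: vsum_ge0.
exact: vsum_ge0.
Unshelve. all: by end_near. Qed.

(* Otherwise pick [w k >= 0] with [~ w k <= e] and [(k+1) w k] summable. If the
   sum is at most [n e], then [(n+1) w n <= n e], so [w n <= e]. *)
Lemma strong_unit_ball (e : X) : strong_unit e ->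
  exists2 d : R, 0 < d & forall w : X, 0 <= w -> `|w| < d -> w <= e.
Proof.
move=> [e0 he]; apply: contrapT => H.
have /choice[w hw] : forall k : nat, exists w : X,
    [/\ 0 <= w, `|w *+ k.+1| <= geometric 1 2^-1 k & ~ w <= e].
  move=> k; apply: contrapT => Hk; apply: H.
  (* This radius makes [w *+ k.+1] at most the geometric term in norm. *)
  exists (2^-1 ^+ k / k.+1%:R); first by rewrite divr_gt0// exprn_gt0.
  move=> w w0 wd; apply: contrapT => we; apply: Hk; exists w; split => //.
  by rewrite /geometric/= mul1r normrMn -(mulr_natr `|w|) -ler_pdivlMr ?ltr0Sn// ltW.
pose v k := w k *+ k.+1.
have v0 k : 0 <= v k by apply: vmulrn_ge0; case: (hw k).
have cv : cvgn (series v).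
  (* Completeness enters here: absolute convergence implies convergence. *)
  apply: normed_cvg; apply: (series_le_cvg (v_ := geometric 1 2^-1)).
  - by move=> n /=; exact: normr_ge0.
  - by move=> n; rewrite /geometric/= mul1r exprn_ge0.
  - by move=> n; case: (hw n).
  - by apply: is_cvg_geometric_series; rewrite ger0_norm ?invf_lt1 ?ltr1n.
have [n vn] := he _ (le_trans (v0 0%N) (vle_lim_series 0 v0 cv)).
case: (hw n) => _ _; apply; rewrite -(vmulrSn_le _ _ n).
apply: le_trans (vle_lim_series n v0 cv) (le_trans vn _).
by rewrite mulrSr -[leLHS]addr0 vleD.
Qed.

(** The excess [z = y - y /\ e] is disjoint from [e], hence from every multiple of [e]; since some
    multiple dominates [z], [z <= 0]. *)
Lemma strong_unit_meet_le (e y : X) : strong_unit e -> 0 <= y ->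
  Order.meet y (e *+ 2) <= e -> y <= e.
Proof.
move=> [e0 he] y0 ye.
have z0 : 0 <= y - Order.meet y e by rewrite vsubr_ge0 leIl.
have ze : Order.meet (y - Order.meet y e) e <= 0.
  suff h : Order.meet (y - Order.meet y e) e + Order.meet y e
           <= Order.meet y e.
    by have /(vleD2r (- Order.meet y e)) := h; rewrite addrK subrr.
  rewrite lexI; apply/andP; split.
    by rewrite -[leRHS](subrK (Order.meet y e)) vleD2r// leIl.
  (* The sum is below [y] and below [e + e], so the hypothesis on [y /\ 2e] applies; this is why the
     factor 2 appears. *)
  apply: le_trans ye; rewrite lexI; apply/andP; split.
    by rewrite -[leRHS](subrK (Order.meet y e)) vleD2r// leIl.
  by rewrite mulr2n; apply: vleD; exact: leIr.
have [n zn] := he _ z0.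
have : y - Order.meet y e <= 0.
  have := meet_mulrn_le0 n e0 z0; rewrite meetC => /(_ ze).
  by rewrite meetC (meet_idPl zn).
by rewrite vsubr_le add0r lexI lexx.
Qed.

Lemma un_ball_bounded_le (eps C : R) (u : X) : 0 <= u ->
  (forall x, un_ball eps u x -> `|x| < C) ->
  forall x, 0 <= x -> un_ball eps u x -> x <= u.
Proof.
move=> u0 uC x x0 ux.
have y0 : 0 <= x - Order.meet x u by rewrite vsubr_ge0 leIl.
have yC n : `|x - Order.meet x u| *+ n < C.
  rewrite -normrMn; apply: uC; apply: le_lt_trans ux; apply: vler_norm.
    by rewrite lexI modulus_ge0.
  by rewrite !modulus_id ?vmulrn_ge0// meet_mulrn_sub_le.
have : `|x - Order.meet x u| <= 0.
  rewrite leNgt; apply/negP => p0.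
  (* By the Archimedean property, the multiples of a positive norm cannot all stay below [C]. *)
  have C0 : 0 <= C by apply: ltW; have := yC 0%N; rewrite mulr0n.
  have := archi_boundP (divr_ge0 C0 (ltW p0)).
  by rewrite ltr_pdivrMr// mulr_natl ltNge ltW.
rewrite normr_le0 subr_eq0 => /eqP ->; exact: leIr.
Qed.

Lemma un_open_open (A : set X) : un_open A -> open A.
Proof.
rewrite /un_open !openE => oA x /oA [[e u] [/= e0 u0] uA].
apply/nbhs_ballP; exists e => //= y; rewrite -ball_normE/= distrC => xy.
by apply: uA; apply: le_lt_trans xy; exact: normr_meet_le.
Qed.

End UnTopologyStrongUnit.

Theorem theorem2p3 (R : realType) (X : banachLatticeType R) :
  (forall A : set X, un_open A <-> open A) <->
  (exists e : X, strong_unit e).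
Proof.
split=> [unE|[e eU] A].
(* Un-openness of the unit ball supplies a norm bounded [V_{eps,u}]. *)
- have : un_open (ball (0 : X) 1) by apply/unE; exact: ball_open.
  rewrite /un_open openE => /(_ 0 (ballxx _ ltr01)) [[eps u] [/= e0 u0] uB].
  exists u; split => // x x0.
  have uC y : un_ball eps u y -> `|y| < 1.
    move=> uy; have := uB y; rewrite /= subr0 => /(_ uy).
    by rewrite -ball_normE/= sub0r normrN.
  pose n := Num.bound (`|x| / eps).
  have xn : `|x| < eps * n.+1%:R.
    rewrite mulrC -ltr_pdivrMr//.
    apply: lt_trans (archi_boundP _) _; first by rewrite divr_ge0// ltW.
    by rewrite ltr_nat.
  pose y := n.+1%:R^-1 *: x.
  have xE : x = y *+ n.+1.
    by rewrite -scaler_nat scalerA mulfV ?pnatr_eq0// scale1r.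
  have y0 : 0 <= y by rewrite vscale_ge0.
  exists n.+1; rewrite xE; apply: vmulrn_le.
  apply: (un_ball_bounded_le _ uC) => //.
  apply: le_lt_trans (normr_meet_le _ u0) _.
  by rewrite -(ltr_pM2r (ltr0Sn R n)) mulr_natr -normrMn -xE.
- split; first exact: un_open_open.
  have [d d0 dP] := strong_unit_ball eU; have [e0 _] := eU.
  have e20 : 0 <= e *+ 2 by exact: vmulrn_ge0.
  rewrite /un_open !openE => oA x /oA /nbhs_ballP[r /= r0 rA].
  (* The bound [d] forces the modulus of [y - x] below [e]; its meet with [2e] is then itself, and
     [r] bounds its norm. *)
  exists (Num.min r d, e *+ 2); first by split => //=; rewrite lt_min r0.
  move=> y; rewrite /un_ball/= lt_min => /andP[yr yd].
  apply: rA; rewrite -ball_normE/= distrC -normr_modulus.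
  have m0 := modulus_ge0 (y - x).
  have ye : modulus (y - x) <= e.
    by apply: strong_unit_meet_le => //; apply: dP => //; rewrite lexI m0.
  move: yr; rewrite (meet_idPl _)//; apply: le_trans ye _.
  by rewrite mulr2n -[leLHS]addr0 vleD.
Qed.
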